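(* Let $X$ be a finite bikei, $A$ an abelian group and $\phi\in H^2_{BK}(X;A)$. If $D$ and $D'$ are unoriented marked vertex diagrams related by a finite sequence of Reidemeister moves and Yoshikawa moves, then $$\Phi^{\phi,M}_X(D)=\Phi^{\phi,M}_X(D')\quad\text{and}\quad \Phi^{\phi}_X(D)=\Phi^{\phi}_X(D').$$
   Context: A bikei is a set $X$ with two binary operations $\underline{\ast},\overline{\ast}:X\times X\to X$ such that for all $x,y,z\in X$: (i) $x\,\underline{\ast}\,x=x\,\overline{\ast}\,x$; (ii) $(x\,\overline{\ast}\,y)\,\overline{\ast}\,y=x$, $(x\,\underline{\ast}\,y)\,\underline{\ast}\,y=x$, $x\,\underline{\ast}\,(y\,\overline{\ast}\,x)=x\,\underline{\ast}\,y$, $x\,\overline{\ast}\,(y\,\underline{\ast}\,x)=x\,\overline{\ast}\,y$; (iii) (exchange laws) $(x\,\overline{\ast}\,y)\,\overline{\ast}\,(z\,\overline{\ast}\,y)=(x\,\overline{\ast}\,z)\,\overline{\ast}\,(y\,\underline{\ast}\,z)$, $(x\,\underline{\ast}\,y)\,\overline{\ast}\,(z\,\underline{\ast}\,y)=(x\,\overline{\ast}\,z)\,\underline{\ast}\,(y\,\overline{\ast}\,z)$, $(x\,\underline{\ast}\,y)\,\underline{\ast}\,(z\,\underline{\ast}\,y)=(x\,\underline{\ast}\,z)\,\underline{\ast}\,(y\,\overline{\ast}\,z)$. A bikei homomorphism is a map preserving both operations. Bikei cohomology. For an abelian group $A$, set $C_n(X;A)=A[X^n]$ for $n\ge 1$,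 and $C_n(X;A)=\{0\}$ otherwise. The boundary map $\partial_n:C_n(X;A)\to C_{n-1}(X;A)$ is the linear extension of $$\partial_n(x_1,\dots,x_n)=\sum_{k=1}^n(-1)^{k-1}\left(\partial^1_k(x_1,\dots,x_n)-\partial^2_k(x_1,\dots,x_n)\right),$$ where $\partial^1_k(x_1,\dots,x_n)=(x_1,\dots,x_{k-1},x_{k+1},\dots,x_n)$ and $\partial^2_k(x_1,\dots,x_n)=(x_1\,\underline{\ast}\,x_k,\dots,x_{k-1}\,\underline{\ast}\,x_k,x_{k+1}\,\overline{\ast}\,x_k,\dots,x_n\,\overline{\ast}\,x_k)$ for $n\geq2$; $\partial_1=0$. The bikei degenerate subcomplex $C^{BD}_n(X;A)$ is generated by all $A$-multiples of: for $n=1$, $(x)-(x\,\underline{\ast}\,y)$ and $(x)-(x\,\overline{\ast}\,y)$; for $n=2$, $(x,x)$, $(x,y)-(x\,\underline{\ast}\,y,\,y\,\overline{\ast}\,x)$, $(x,y)+(x,\,y\,\overline{\ast}\,x)$ and $(x,y)+(x\,\underline{\ast}\,y,\,y)$; for $n\ge 3$, all $(x_1,\dots,x_n)$ with $x_j=x_{j+1}$ for some $j$. Put $C^{BK}_n=C_n/C^{BD}_n$. Then $H^n_{BK}(X;A)=\mathrm{Ker}\,\delta^{n+1}/\mathrm{Im}\,\delta^n$, where $\delta^n\phi=\phi\circ\partial_n$ and degree-$n$ cochains are homomorphisms $C^{BK}_n(X;\mathbb{Z})\to A$. An element of $H^2_{BK}(X;A)$ and a 2-cocycle representing it, viewed as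 a function $\phi:X\times X\to A$, are denoted by the same symbol. Marked vertex diagrams. An unoriented marked vertex diagram (marked graph diagram) is a planar diagram like an unoriented link diagram which, besides ordinary crossings, may have saddle crossings: 4-valent vertices, each marked with a small bar giving the direction of a saddle. Such diagrams represent unoriented (possibly non-orientable) knotted surfaces in $\mathbb{R}^4$ (closed if both resolutions of the saddles yield unlinks, otherwise cobordisms between the resolved links). The moves considered are the Reidemeister moves I, II, III on ordinary crossings and the standard Yoshikawa moves IV–VIII: (IV) a strand passing entirely over (or entirely under) a marked vertex is slid from one side of the vertex to the other, so that it crosses two adjacent arms before and the two opposite arms after; (V) a single crossing between two adjacent arms of a marked vertex is moved to the two opposite arms (flipping the vertex); (VI) a marked vertex two of whose adjacent arms are joined by a crossingless loop is replaced by a plain arc (for both marker positions); (VII) a connected crossingless local tangle with two marked vertices is replaced by another such tangle with the same endpoints (Yoshikawa's band-slide move); (VIII) two marked vertices, where two adjacent parallel arms of the first cross over two adjacent parallel arms of the second (four ordinary crossings), are replaced by the same configuration with these arms of the first crossing under those of the second (Yoshikawa's band-pass move). Markers are positioned as in Yoshikawa's standard list of moves; they play no role in the colorings and Boltzmann weights. Colorings. The semiarcs of $D$ are the portions obtained by cutting at every crossing point (on both over- and under-strand) and at every saddle crossing. At each ordinary crossing, place the crossing by a planar rotation so that the overstrand runs from upper right to lower left and the understrand from upper left to lower right. If $x$ is the upper-left (under) semiarc and $y$ is the upper-right (over) semiarc, the crossing relations are: the lower-right (under) semiarc is $x\,\underline{\ast}\,y$ and the lower-left (over) semiarc is $y\,\overline{\ast}\,x$.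 All four semiarcs meeting at a saddle crossing are set equal. The fundamental bikei $\mathcal{BK}(D)$ is the bikei generated by the semiarcs subject to these relations (bikei words in the semiarcs modulo the bikei axioms and these relations). A homomorphism $f:\mathcal{BK}(D)\to X$ is the same as an assignment of elements of $X$ to the semiarcs satisfying all these relations; $D_f$ denotes the resulting colored diagram. Invariants. For $f\in\mathrm{Hom}(\mathcal{BK}(D),X)$, the Boltzmann weight of an ordinary crossing, placed by a planar rotation so that the overstrand runs from upper right to lower left and the understrand from upper left to lower right, is $\phi(x,y)$, where $x$ and $y$ are the colors of the under and over semiarcs (upper left and upper right respectively). The Boltzmann weight $BW(D_f)\in A$ is the sum of the weights over all ordinary (non-saddle) crossings of $D_f$. Define the multiset $\Phi^{\phi,M}_X(D)=\{BW(D_f)\mid f\in\mathrm{Hom}(\mathcal{BK}(D),X)\}$ and the formal sum $\Phi^{\phi}_X(D)=\sum_{f\in\mathrm{Hom}(\mathcal{BK}(D),X)}u^{BW(D_f)}$, where $u$ is a dummy variable with formal exponents in $A$. *)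

(* Defs.v *)
From HB Require Import structures.
From Stdlib Require Import Relation_Operators.
From mathcomp Require Import all_boot all_order all_algebra.
From mathcomp Require Import boolp finmap multiset monalg.

Set Implicit Arguments.
Unset Strict Implicit.
Unset Printing Implicit Defensive.

Import GRing.Theory.

Local Open Scope quotient_scope.

Reserved Notation "x \un y" (at level 40, left associativity).
Reserved Notation "x \ov y" (at level 40, left associativity).

(** [x \un y] is x * y with the underlined star, [x \ov y] with the
    overlined one. *)
HB.mixin Record isBikei (X : Type) := {
  bun : X -> X -> X;
  bov : X -> X -> X;
  bikei_diag : forall x, bun x x = bov x x;
  bikei_ovK : forall x y, bov (bov x y) y = x;
  bikei_unK : forall x y, bun (bun x y) y = x;
  bikei_un_ov : forall x y, bun x (bov y x) = bun x y;
  bikei_ov_un : forall x y, bov x (bun y x) = bov x y;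
  bikei_exch_oo : forall x y z,
    bov (bov x y) (bov z y) = bov (bov x z) (bun y z);
  bikei_exch_uo : forall x y z,
    bov (bun x y) (bun z y) = bun (bov x z) (bov y z);
  bikei_exch_uu : forall x y z,
    bun (bun x y) (bun z y) = bun (bun x z) (bov y z)
}.

#[short(type="bikeiType")]
HB.structure Definition Bikei := {X of isBikei X & Choice X}.

#[short(type="finBikeiType")]
HB.structure Definition FinBikei := {X of isBikei X & Finite X}.

Notation "x \un y" := (bun x y).
Notation "x \ov y" := (bov x y).

Record bikei_hom (B X : bikeiType) := BikeiHom {
  bikei_hom_fun :> B -> X;
  bikei_hom_un : {morph bikei_hom_fun : x y / x \un y};
  bikei_hom_ov : {morph bikei_hom_fun : x y / x \ov y}
}.

Section Cohomology.
Variable X : bikeiType.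
Local Open Scope ring_scope.

(** The free abelian group Z[X^n].  The convention that the complex vanishes
    in degree 0 is implemented by declaring all of [chain 0] degenerate, so
    that [BKchain 0] is the zero group. *)
Definition chain (n : nat) := {malg int[n.-tuple X]}.

Definition face1 n (t : n.+1.-tuple X) (k : 'I_n.+1) : n.-tuple X :=
  [tuple tnth t (lift k j) | j < n].

(** For [j < k], [lift k j] has value [j]; otherwise it has value [j.+1]. *)
Definition face2 n (t : n.+1.-tuple X) (k : 'I_n.+1) : n.-tuple X :=
  [tuple if (j < k)%N then tnth t (lift k j) \un tnth t k
         else tnth t (lift k j) \ov tnth t k | j < n].

Definition tuple_boundary n (t : n.+1.-tuple X) : chain n :=
  \sum_(k < n.+1) (-1) ^+ k *: (<< face1 t k >> - << face2 t k >>).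

(** The indices [k] start at 0, so the sign is the usual (-1)^(k-1).  For
    [n = 0] the two faces coincide, so this is zero. *)
Definition boundary n (c : chain n.+1) : chain n :=
  \sum_(t <- msupp c) c@_t *: tuple_boundary t.

Inductive degenerate : forall n, chain n -> Prop :=
| Degenerate0 (c : chain 0) : degenerate c
| Degenerate1_un x y :
    degenerate (<< [tuple x] >> - << [tuple x \un y] >> : chain 1)
| Degenerate1_ov x y :
    degenerate (<< [tuple x] >> - << [tuple x \ov y] >> : chain 1)
| Degenerate2_diag x : degenerate (<< [tuple x; x] >> : chain 2)
| Degenerate2_both x y :
    degenerate
      (<< [tuple x; y] >> - << [tuple x \un y; y \ov x] >> : chain 2)
| Degenerate2_ov x y :
    degenerate (<< [tuple x; y] >> + << [tuple x; y \ov x] >> : chain 2)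
| Degenerate2_un x y :
    degenerate (<< [tuple x; y] >> + << [tuple x \un y; y] >> : chain 2)
| Degenerate3 n (t : n.+3.-tuple X) (i j : 'I_n.+3) :
    j = i.+1 :> nat -> tnth t i = tnth t j -> degenerate (<< t >> : chain n.+3).

Inductive BDchain n : chain n -> Prop :=
| BDchain_gen c : degenerate c -> BDchain c
| BDchain0 : BDchain 0
| BDchainB c c' : BDchain c -> BDchain c' -> BDchain (c - c').

Definition BD n : {pred chain n} := fun c => `[< BDchain c >].

Fact BD_zmod_closed n : zmod_closed (@BD n).
Proof.
split=> [|c c' /asboolP cP /asboolP c'P]; apply/asboolP.
  exact: BDchain0.
exact: BDchainB.
Qed.

HB.instance Definition _ n :=
  GRing.isZmodClosed.Build (chain n) (@BD n) (@BD_zmod_closed n).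

Definition BKchain n := Quotient.quot (@BD n).
HB.instance Definition _ n := GRing.Zmodule.on (BKchain n).

Definition BKproj n (c : chain n) : BKchain n := \pi_(Quotient.quot (@BD n)) c.

Variable A : zmodType.

Definition cochain n := {additive BKchain n -> A}.

(** Stated on [chain n.+1], through the projections. *)
Definition codiff n (phi : cochain n) (c : chain n.+1) : A :=
  phi (BKproj (boundary c)).

Definition cocycle n (phi : cochain n) : Prop := forall c, codiff phi c = 0.

Definition coboundary n : cochain n -> Prop :=
  match n with
  | 0 => fun phi => forall c, phi c = 0
  | m.+1 => fun phi => exists psi : cochain m,
      forall c : chain m.+1, phi (BKproj c) = codiff psi c
  end.

Definition cohomologous n (phi psi : cochain n) : Prop :=
  exists2 beta : cochain n, coboundary beta
    & forall c, phi c = psi c + beta c.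

(** The elements of the n-th cohomology group: cosets of the coboundaries in
    the cocycles, given as predicates on cochains. *)
Record HBK n := HBKClass {
  HBK_coset :> cochain n -> Prop;
  HBK_cosetP : exists2 phi, cocycle phi
    & forall psi, HBK_coset psi <-> cocycle psi /\ cohomologous psi phi
}.

Definition cocycle_fun (phi : cochain 2) (x y : X) : A :=
  phi (BKproj << [tuple x; y] >>).

End Cohomology.

(** A planar diagram is cut into pieces, with labelled ends listed clockwise.
    - [Crossing a b c d] : rotated so that the over-strand runs from upper
      right to lower left, [a] is the upper left (under) end, [b] the upper
      right (over), [c] the lower right (under), [d] the lower left (over).
    - [Saddle m a b c d] : the marker lies in the two sectors (a,b) and (c,d)
      if [m], and in the two sectors (b,c) and (d,a) otherwise.
    - [Joint a b] : a plain point of a strand.  It is not a crossing of any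
      kind and does not cut semiarcs; [Joint a a] is a crossingless circle. *)
Inductive piece (E : Type) :=
| Crossing of E & E & E & E
| Saddle of bool & E & E & E & E
| Joint of E & E.

Section Piece.
Variable E : Type.

Definition ends (p : piece E) : seq E :=
  match p with
  | Crossing a b c d => [:: a; b; c; d]
  | Saddle _ a b c d => [:: a; b; c; d]
  | Joint a b => [:: a; b]
  end.

Definition relabel (F : Type) (f : E -> F) (p : piece E) : piece F :=
  match p with
  | Crossing a b c d => Crossing (f a) (f b) (f c) (f d)
  | Saddle m a b c d => Saddle m (f a) (f b) (f c) (f d)
  | Joint a b => Joint (f a) (f b)
  end.

Definition piece_code (p : piece E) : option bool * seq E :=
  (if p is Saddle m _ _ _ _ then Some m else None, ends p).

Definition piece_decode (c : option bool * seq E) : option (piece E) :=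
  match c with
  | (None, [:: a; b; c; d]) => Some (Crossing a b c d)
  | (Some m, [:: a; b; c; d]) => Some (Saddle m a b c d)
  | (None, [:: a; b]) => Some (Joint a b)
  | _ => None
  end.

Fact piece_codeK : pcancel piece_code piece_decode.
Proof. by case. Qed.

End Piece.

HB.instance Definition _ (E : eqType) :=
  Equality.copy (piece E) (pcan_type (@piece_codeK E)).

(** The combinatorial map of a family of pieces: the darts are the ends of
    the pieces, and ends with equal labels are glued. *)
Section CombinatorialMap.
Variables (E : finType) (P : seq (piece E)).

Definition piece_at (i : 'I_(size P)) := tnth (in_tuple P) i.

Definition dart := {i : 'I_(size P) & 'I_(size (ends (piece_at i)))}.

Definition dart_edge (d : dart) : E :=
  tnth (in_tuple (ends (piece_at (tag d)))) (tagged d).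

Definition dart_next (d : dart) : dart :=
  Tagged (fun i => 'I_(size (ends (piece_at i)))) (ordS (tagged d)).

Definition dart_mate (d : dart) : dart :=
  odflt d [pick d' | (d' != d) && (dart_edge d' == dart_edge d)].

Definition dart_adj : rel dart :=
  [rel d d' | (tag d == tag d') || (dart_edge d == dart_edge d')].

Definition two_ended : bool :=
  [forall e : E, count_mem e (flatten (map (@ends E) P)) == 2].

(** Every component has genus 0, i.e. V - E + F = 2C; the faces are the
    orbits of [dart_next \o dart_mate]. *)
Definition planar : bool :=
  size P + fcard (dart_next \o dart_mate) predT
    == #|E| + 2 * n_comp dart_adj predT.

End CombinatorialMap.

(** A planar diagram up to planar isotopy.  The position of the connected
    components relative to each other and the choice of the outer face are not
    recorded: they can be changed by moving one component over the others,
    i.e. by the moves below. *)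
Record mdiagram := MDiagram {
  edge : finType;
  pieces : seq (piece edge);
  pieces_two_ended : two_ended pieces;
  pieces_planar : planar pieces
}.

(** Local modifications inside a disk.  The labels occurring on both sides are
    the endpoints of the tangle; they need not be distinct.  In [two_ended]
    families the labels occurring on one side only are internal edges. *)
Inductive local_move : seq (piece nat) -> seq (piece nat) -> Prop :=
(* planar isotopy: another way of reading the same piece *)
| Turn_crossing a b c d :
    local_move [:: Crossing a b c d] [:: Crossing c d a b]
| Turn_saddle m a b c d :
    local_move [:: Saddle m a b c d] [:: Saddle (~~ m) b c d a]
| Turn_joint a b :
    local_move [:: Joint a b] [:: Joint b a]
| Move_I a b c :
    local_move [:: Crossing a b c c] [:: Joint a b]
| Move_I' a b c :
    local_move [:: Crossing a c c b] [:: Joint a b]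
(* the strand ab over the strand cd *)
| Move_II a b c d m n :
    local_move [:: Crossing c m n a; Crossing n m d b]
               [:: Joint a b; Joint c d]
(* top ends a1 a2 a3, bottom ends b1 b2 b3, from left to right; in III the
   strand a3 b1 is above the two others, in III' it is the strand a1 b3 *)
| Move_III a1 a2 a3 b1 b2 b3 p q r p' q' r' :
    local_move
      [:: Crossing a1 a2 p q; Crossing p a3 b3 r; Crossing q r b2 b1]
      [:: Crossing a2 a3 p' q'; Crossing a1 q' r' b1; Crossing r' p' b3 b2]
| Move_III' a1 a2 a3 b1 b2 b3 p q r p' q' r' :
    local_move
      [:: Crossing a2 p q a1; Crossing a3 b3 r p; Crossing r b2 b1 q]
      [:: Crossing a3 p' q' a2; Crossing q' r' b1 a1; Crossing p' b3 b2 r']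
(* vertex with arms ending at a, b, c, d clockwise from the upper left; the
   strand st slides over (IV) or under (IV') it, from above to below *)
| Move_IV k a b c d s t m p q m' p' q' :
    local_move
      [:: Crossing a m p s; Crossing b t q m; Saddle k p q c d]
      [:: Saddle k a b q' p'; Crossing p' m' d s; Crossing q' t c m']
| Move_IV' k a b c d s t m p q m' p' q' :
    local_move
      [:: Crossing s a m p; Crossing m b t q; Saddle k p q c d]
      [:: Saddle k a b q' p'; Crossing s p' m' d; Crossing m' q' t c]
(* ends a, b, c, d clockwise from the upper left; the crossing goes from the
   right to the left of the vertex *)
| Move_V k a b c d p q p' q' :
    local_move
      [:: Saddle k a p q d; Crossing p b c q]
      [:: Crossing a p' q' d; Saddle k p' b c q']
| Move_V' k a b c d p q p' q' :
    local_move
      [:: Saddle k a p q d; Crossing b c q p]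
      [:: Crossing p' q' d a; Saddle k p' b c q']
| Move_VI k a b c :
    local_move [:: Saddle k a b c c] [:: Joint a b]
(* endpoints x1, ..., x6 clockwise; on both sides the two smoothings of the
   tangle are x2x3, x4x5, x6x1 and x1x2, x3x4, x5x6 *)
| Move_VII x1 x2 x3 x4 x5 x6 e e' :
    local_move [:: Saddle false x1 x2 x3 e; Saddle false e x4 x5 x6]
               [:: Saddle true x2 x3 x4 e'; Saddle false x1 e' x5 x6]
(* first vertex on the left, its arms p, q running to the right to the ends
   c1, c2; second vertex at the top, its arms r, s running down to the ends
   d1, d2; the two markers are parallel in the plane, hence one runs along its
   pair of parallel arms and the other across *)
| Move_VIII k a1 a2 b1 b2 c1 c2 d1 d2 p q r s p1 q1 r1 s1
    p' q' r' s' p1' q1' r1' s1' :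
    local_move
      [:: Saddle k a1 p q a2; Saddle k b1 b2 s r;
          Crossing r p1 r1 p; Crossing s c1 s1 p1;
          Crossing r1 q1 d1 q; Crossing s1 c2 d2 q1]
      [:: Saddle k a1 p' q' a2; Saddle k b1 b2 s' r';
          Crossing p' r' p1' r1'; Crossing p1' s' c1 s1';
          Crossing q' r1' q1' d1; Crossing q1' s1' c2 d2].

Inductive code_move (P Q : seq (piece nat)) : Prop :=
| Code_reorder of perm_eq P Q
| Code_local T T' R of
    local_move T T' & perm_eq P (T ++ R) & perm_eq Q (T' ++ R)
| Code_joint a b R of
    a != b & perm_eq P (Joint a b :: R)
    & perm_eq Q (map (relabel (fun e => if e == b then a else e)) R).

(** One move between diagrams, their edges being named injectively by numbers,
    so that the parts outside of the modified disk can be compared. *)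
Definition diagram_move (D D' : mdiagram) : Prop :=
  exists (f : edge D -> nat) (g : edge D' -> nat),
    [/\ injective f, injective g
      & code_move (map (relabel f) (pieces D)) (map (relabel g) (pieces D'))].

Definition yoshikawa_equiv : mdiagram -> mdiagram -> Prop :=
  clos_refl_sym_trans mdiagram diagram_move.

Definition joined (D : mdiagram) : rel (edge D) :=
  [rel a b | (Joint a b \in pieces D) || (Joint b a \in pieces D)].

Fact joined_equiv D : equiv_class_of (connect (@joined D)).
Proof.
split=> [a|a b|]; [exact: connect0 | | exact: connect_trans].
by apply: sym_connect_sym => {a b} a b; rewrite /joined /= orbC.
Qed.

Canonical joined_equiv_rel D := EquivRelPack (joined_equiv D).

Definition semiarc (D : mdiagram) := {eq_quot (joined_equiv_rel D)}.
HB.instance Definition _ D := Choice.on (semiarc D).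

Definition semiarc_of (D : mdiagram) (a : edge D) : semiarc D :=
  \pi_{eq_quot (joined_equiv_rel D)} a.

Inductive bword (S : Type) :=
| Gen of S
| Un of bword S & bword S
| Ov of bword S & bword S.

HB.instance Definition _ S := gen_eqMixin (bword S).
HB.instance Definition _ S := gen_choiceMixin (bword S).

Section FundamentalBikei.
Variable D : mdiagram.

Notation word := (bword (semiarc D)).
Notation arc a := (Gen (semiarc_of a)).

Inductive bk_eq : word -> word -> Prop :=
| bk_refl u : bk_eq u u
| bk_sym u v : bk_eq u v -> bk_eq v u
| bk_trans u v w : bk_eq u v -> bk_eq v w -> bk_eq u w
| bk_congr_un u u' v v' : bk_eq u u' -> bk_eq v v' -> bk_eq (Un u v) (Un u' v')
| bk_congr_ov u u' v v' : bk_eq u u' -> bk_eq v v' -> bk_eq (Ov u v) (Ov u' v')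
| bk_diag u : bk_eq (Un u u) (Ov u u)
| bk_ovK u v : bk_eq (Ov (Ov u v) v) u
| bk_unK u v : bk_eq (Un (Un u v) v) u
| bk_un_ov u v : bk_eq (Un u (Ov v u)) (Un u v)
| bk_ov_un u v : bk_eq (Ov u (Un v u)) (Ov u v)
| bk_exch_oo u v w : bk_eq (Ov (Ov u v) (Ov w v)) (Ov (Ov u w) (Un v w))
| bk_exch_uo u v w : bk_eq (Ov (Un u v) (Un w v)) (Un (Ov u w) (Ov v w))
| bk_exch_uu u v w : bk_eq (Un (Un u v) (Un w v)) (Un (Un u w) (Ov v w))
| bk_crossing_under a b c d :
    Crossing a b c d \in pieces D -> bk_eq (arc c) (Un (arc a) (arc b))
| bk_crossing_over a b c d :
    Crossing a b c d \in pieces D -> bk_eq (arc d) (Ov (arc b) (arc a))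
| bk_saddle12 m a b c d :
    Saddle m a b c d \in pieces D -> bk_eq (arc a) (arc b)
| bk_saddle23 m a b c d :
    Saddle m a b c d \in pieces D -> bk_eq (arc b) (arc c)
| bk_saddle34 m a b c d :
    Saddle m a b c d \in pieces D -> bk_eq (arc c) (arc d).

Definition bk_rel : rel word := fun u v => `[< bk_eq u v >].

Fact bk_rel_equiv : equiv_class_of bk_rel.
Proof.
split=> [u|u v|v u w].
- by apply/asboolP; apply: bk_refl.
- by apply/asboolP/asboolP; apply: bk_sym.
- by move=> /asboolP uv /asboolP vw; apply/asboolP; apply: bk_trans vw.
Qed.

Canonical bk_equiv_rel := EquivRelPack bk_rel_equiv.

Definition fundamental_bikei := {eq_quot bk_equiv_rel}.
HB.instance Definition _ := Choice.on fundamental_bikei.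
HB.instance Definition _ := EqQuotient.on fundamental_bikei.

Definition bk_class (u : word) : fundamental_bikei := \pi_fundamental_bikei u.

Definition bk_un (x y : fundamental_bikei) := bk_class (Un (repr x) (repr y)).
Definition bk_ov (x y : fundamental_bikei) := bk_class (Ov (repr x) (repr y)).

Fact bk_classP u v : bk_class u = bk_class v <-> bk_eq u v.
Proof.
split=> [/eqquotP/asboolP // | uv]; first by apply/eqquotP/asboolP.
Qed.

Fact bk_unE u v : bk_un (bk_class u) (bk_class v) = bk_class (Un u v).
Proof.
by apply/bk_classP; apply: bk_congr_un; apply/bk_classP; rewrite /bk_class reprK.
Qed.

Fact bk_ovE u v : bk_ov (bk_class u) (bk_class v) = bk_class (Ov u v).
Proof.
by apply/bk_classP; apply: bk_congr_ov; apply/bk_classP; rewrite /bk_class reprK.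
Qed.

Fact bk_classW (Q : fundamental_bikei -> Prop) :
  (forall u, Q (bk_class u)) -> forall x, Q x.
Proof. by move=> QP x; rewrite -[x]reprK; apply: QP. Qed.

Ltac bk_lift lem :=
  repeat (elim/bk_classW => ?); rewrite ?(bk_unE, bk_ovE);
  apply/bk_classP; apply: lem.

Fact bkP_diag x : bk_un x x = bk_ov x x.
Proof. by move: x; bk_lift bk_diag. Qed.
Fact bkP_ovK x y : bk_ov (bk_ov x y) y = x.
Proof. by move: x y; bk_lift bk_ovK. Qed.
Fact bkP_unK x y : bk_un (bk_un x y) y = x.
Proof. by move: x y; bk_lift bk_unK. Qed.
Fact bkP_un_ov x y : bk_un x (bk_ov y x) = bk_un x y.
Proof. by move: x y; bk_lift bk_un_ov. Qed.
Fact bkP_ov_un x y : bk_ov x (bk_un y x) = bk_ov x y.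
Proof. by move: x y; bk_lift bk_ov_un. Qed.
Fact bkP_exch_oo x y z :
  bk_ov (bk_ov x y) (bk_ov z y) = bk_ov (bk_ov x z) (bk_un y z).
Proof. by move: x y z; bk_lift bk_exch_oo. Qed.
Fact bkP_exch_uo x y z :
  bk_ov (bk_un x y) (bk_un z y) = bk_un (bk_ov x z) (bk_ov y z).
Proof. by move: x y z; bk_lift bk_exch_uo. Qed.
Fact bkP_exch_uu x y z :
  bk_un (bk_un x y) (bk_un z y) = bk_un (bk_un x z) (bk_ov y z).
Proof. by move: x y z; bk_lift bk_exch_uu. Qed.

HB.instance Definition _ := isBikei.Build fundamental_bikei
  bkP_diag bkP_ovK bkP_unK bkP_un_ov bkP_ov_un
  bkP_exch_oo bkP_exch_uo bkP_exch_uu.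

End FundamentalBikei.

Section Invariants.
Variables (D : mdiagram) (X : finBikeiType).

Notation coloring := (bikei_hom (fundamental_bikei D) X).

Definition color (f : coloring) (a : edge D) : X :=
  f (bk_class (Gen (semiarc_of a))).

Definition color_ffun (f : coloring) : {ffun edge D -> X} :=
  [ffun a => color f a].

Fact color_ffun_inj : injective color_ffun.
Proof.
move=> f g fg.
have fgE x : f x = g x.
  elim/bk_classW: x; elim=> [s|u IHu v IHv|u IHu v IHv].
  - rewrite -[s]reprK; move/ffunP/(_ (repr s)): fg.
    by rewrite !ffunE.
  - by rewrite -bk_unE (bikei_hom_un f) (bikei_hom_un g) IHu IHv.
  - by rewrite -bk_ovE (bikei_hom_ov f) (bikei_hom_ov g) IHu IHv.
case: f g fgE {fg} => [f fu fo] [g gu go] /= /funext fg.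
by case: _ / fg in gu go *; congr BikeiHom; apply: Prop_irrelevance.
Qed.

Definition coloring_of (c : {ffun edge D -> X}) : option coloring :=
  if pselect (exists f, color_ffun f = c) is left fP then Some (projT1 (cid fP))
  else None.

Fact color_ffunK : pcancel color_ffun coloring_of.
Proof.
move=> f; rewrite /coloring_of; case: pselect => [fP|[]]; last by exists f.
by case: cid => g /= /color_ffun_inj ->.
Qed.

End Invariants.

HB.instance Definition _ D (X : finBikeiType) :=
  Finite.copy (bikei_hom (fundamental_bikei D) X)
              (pcan_type (@color_ffunK D X)).

Section Polynomials.
Variables (X : finBikeiType) (A : zmodType) (phi : X -> X -> A).
Local Open Scope ring_scope.

Definition BW (D : mdiagram) (f : bikei_hom (fundamental_bikei D) X) : A :=
  \sum_(p <- pieces D)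
    (if p is Crossing a b _ _ then phi (color f a) (color f b) else 0).

Definition PhiM (D : mdiagram) : {mset A}%mset :=
  seq_mset [seq BW f | f : bikei_hom (fundamental_bikei D) X].

(** Formal sums of powers of [u] with exponents in [A], i.e. the free abelian
    group on [A]; [<< a >>] stands for u^a. *)
Definition Phi (D : mdiagram) : {malg int[A]} :=
  \sum_(f : bikei_hom (fundamental_bikei D) X) << BW f >>.

End Polynomials.

(* Main.v *)
From HB Require Import structures.
Require Import Defs.
From mathcomp Require Import all_boot all_algebra finmap multiset monalg.
From mathcomp Require Import boolp ring.

(** A homomorphism from the fundamental bikei is the same as a coloring of the
    edges satisfying the relations of all pieces.  In each local move the
    colors of the internal edges are determined by those of the endpoints, and
    the two tangles impose the same condition on the colors of the endpoints.
    Under this condition they also have the same total weight: for the moves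
    III this is the cocycle identity, for all other moves the weights vanish or
    cancel by the degenerate relations.  Hence every move induces a
    weight-preserving bijection between colorings. *)

Set Implicit Arguments.
Unset Strict Implicit.
Unset Printing Implicit Defensive.

Import GRing.Theory.

(** * The laws satisfied by a cocycle *)

(** The first four laws express vanishing on the degenerate generators of degree 2. The last
    expresses vanishing on the boundary of [(x, y, z)], with the negative terms moved to the
    right. *)
Record cocycle_laws (X : bikeiType) (A : zmodType) (w : X -> X -> A) : Prop :=
  CocycleLaws {
  weight_diag : forall x, w x x = 0%R;
  weight_both : forall x y, w (x \un y) (y \ov x) = w x y;
  weight_ov : forall x y, w x (y \ov x) = (- w x y)%R;
  weight_un : forall x y, w (x \un y) y = (- w x y)%R;
  weight_cocycle : forall x y z,
    (w x y + w y z + w (x \un y) (z \ov y)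
      = w x z + w (y \ov x) (z \ov x) + w (x \un z) (y \un z))%R
}.

Lemma alternating_sum3 (R : pzRingType) (V : lmodType R) (F : 'I_3 -> V) :
  (\sum_(k < 3) (-1) ^+ k *: F k =
    F ord0 - F (lift ord0 ord0) + F (lift ord0 (lift ord0 ord0)))%R.
Proof.
by rewrite !big_ord_recl big_ord0 addr0 addrA /= expr0 expr1 sqrrN expr1n
           scaleN1r !scale1r.
Qed.

Lemma additive_signed_sum (V W : zmodType) (g : {additive V -> W})
    (a b c d e f : V) :
  (g (a - b - (c - d) + (e - f)) = 0 -> g e + g a + g d = g c + g b + g f)%R.
Proof.
rewrite !(raddfD, raddfN) => E; apply: subr0_eq; rewrite -[RHS]E.
by rewrite !opprD !opprK !addrA [RHS](ACl (5*1*4*3*2*6)).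
Qed.

Section CocycleFun.
Variables (X : bikeiType) (A : zmodType).
Local Open Scope ring_scope.

Lemma BKproj_degenerate n (c : chain X n) : degenerate c -> BKproj c = 0.
Proof.
move=> cP; rewrite /BKproj -[RHS](raddf0 (\pi_(Quotient.quot (@BD X n)))%qT).
by apply/eqP; rewrite -Quotient.idealrBE subr0; apply/asboolP/BDchain_gen.
Qed.

Lemma BKproj_zmod_morphism n : zmod_morphism (@BKproj X n).
Proof. by move=> c d; rewrite /BKproj raddfB. Qed.

HB.instance Definition _ n :=
  GRing.isZmodMorphism.Build (chain X n) (BKchain X n) (@BKproj X n)
    (@BKproj_zmod_morphism n).

Lemma boundaryU n (t : n.+1.-tuple X) : boundary << t >> = tuple_boundary t.
Proof. by rewrite /boundary msuppU oner_eq0 big_seq_fset1 mcoeffUU scale1r. Qed.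

Let pairU (x y : X) : chain X 2 := << [tuple x; y] >>.

Lemma tuple_boundary3 (x y z : X) :
  tuple_boundary [tuple x; y; z] =
    pairU y z - pairU (y \ov x) (z \ov x)
    - (pairU x z - pairU (x \un y) (z \ov y))
    + (pairU x y - pairU (x \un z) (y \un z)).
Proof.
set t := [tuple x; y; z].
have f10 : face1 t ord0 = [tuple y; z].
  by apply: eq_from_tnth => -[[|[|//]] ?]; rewrite tnth_mktuple !(tnth_nth x).
have f11 : face1 t (lift ord0 ord0) = [tuple x; z].
  by apply: eq_from_tnth => -[[|[|//]] ?]; rewrite tnth_mktuple !(tnth_nth x).
have f12 : face1 t (lift ord0 (lift ord0 ord0)) = [tuple x; y].
  by apply: eq_from_tnth => -[[|[|//]] ?]; rewrite tnth_mktuple !(tnth_nth x).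
have f20 : face2 t ord0 = [tuple y \ov x; z \ov x].
  by apply: eq_from_tnth => -[[|[|//]] ?]; rewrite tnth_mktuple !(tnth_nth x).
have f21 : face2 t (lift ord0 ord0) = [tuple x \un y; z \ov y].
  by apply: eq_from_tnth => -[[|[|//]] ?]; rewrite tnth_mktuple !(tnth_nth x).
have f22 : face2 t (lift ord0 (lift ord0 ord0)) = [tuple x \un z; y \un z].
  by apply: eq_from_tnth => -[[|[|//]] ?]; rewrite tnth_mktuple !(tnth_nth x).
by rewrite /tuple_boundary alternating_sum3 f10 f11 f12 f20 f21 f22.
Qed.

Lemma cocycle_fun_laws (phi : cochain X A 2) :
  cocycle phi -> cocycle_laws (cocycle_fun phi).
Proof.
move=> phiP; rewrite /cocycle_fun.
have degB (s t : 2.-tuple X) : degenerate (<< s >> - << t >> : chain X 2) ->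
    phi (BKproj << t >>) = phi (BKproj << s >>).
  by move=> /BKproj_degenerate /(congr1 phi) /eqP;
     rewrite !raddfB raddf0 subr_eq0 => /eqP.
have degD (s t : 2.-tuple X) : degenerate (<< s >> + << t >> : chain X 2) ->
    phi (BKproj << t >>) = - phi (BKproj << s >>).
  by move=> /BKproj_degenerate /(congr1 phi) /eqP;
     rewrite !raddfD raddf0 addrC addr_eq0 => /eqP.
split=> [x|x y|x y|x y|x y z].
- by rewrite (BKproj_degenerate (Degenerate2_diag x)) raddf0.
- exact/degB/Degenerate2_both.
- exact/degD/Degenerate2_ov.
- exact/degD/Degenerate2_un.
have := phiP << [tuple x; y; z] >>; rewrite /codiff boundaryU tuple_boundary3.
by move=> /(@additive_signed_sum _ _ (phi \o @BKproj X 2)).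
Qed.

End CocycleFun.

(** * Bikei identities *)

Section BikeiTheory.
Variable X : bikeiType.
Implicit Types a b c d x y z : X.

Lemma un_injr y : injective (fun x => x \un y).
Proof. by apply: (can_inj (g := fun x => x \un y)) => x; apply: bikei_unK. Qed.

Lemma ov_injr y : injective (fun x => x \ov y).
Proof. by apply: (can_inj (g := fun x => x \ov y)) => x; apply: bikei_ovK. Qed.

(** Together with [ov_crossK]: passing from the upper to the lower ends of a crossing is an
    involution, the algebraic form of a half turn. Replacing [b \ov a] by [b \ov (a \un b)] makes
    [bikei_un_ov] applicable. *)
Lemma un_crossK a b : (a \un b) \un (b \ov a) = a.
Proof. by rewrite -[b \ov a]bikei_ov_un bikei_un_ov bikei_unK. Qed.

Lemma ov_crossK a b : (b \ov a) \ov (a \un b) = b.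
Proof. by rewrite -[a \un b]bikei_un_ov bikei_ov_un bikei_ovK. Qed.

Lemma un_diagK a : (a \un a) \un (a \un a) = a.
Proof. by rewrite [X in _ \un X]bikei_diag un_crossK. Qed.

Lemma ov_diagK a : (a \un a) \ov a = a.
Proof. by rewrite bikei_diag bikei_ovK. Qed.

Lemma un_un_diag a : a \un (a \un a) = a \un a.
Proof. by rewrite [X in _ \un X]bikei_diag bikei_un_ov. Qed.

Definition bikei_simpl := (@bikei_unK X, @bikei_ovK X, un_crossK, ov_crossK,
  @bikei_un_ov X, @bikei_ov_un X, un_diagK, ov_diagK, un_un_diag).

Lemma crossing_turn a b c d :
  (c == a \un b) && (d == b \ov a) = (a == c \un d) && (b == d \ov c).
Proof. by apply/andP/andP=> -[/eqP-> /eqP->]; rewrite !bikei_simpl !eqxx. Qed.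

Lemma crossing_loop_out a b c :
  (c == a \un b) && (c == b \ov a) = (a == b) && (c == a \un a).
Proof.
apply/idP/idP.
  rewrite crossing_turn -bikei_diag => /andP[/eqP-> /eqP->].
  by rewrite un_diagK !eqxx.
by move=> /andP[/eqP-> /eqP->]; rewrite -bikei_diag eqxx.
Qed.

Lemma crossing_loop_side a b c :
  (c == a \un c) && (b == c \ov a) = (a == b) && (c == a \un a).
Proof.
apply/idP/idP=> [/andP[/eqP cE /eqP->]|/andP[/eqP<- /eqP->]]; last first.
  by rewrite un_un_diag ov_diagK !eqxx.
(* The loop color [c] is given only implicitly; cancelling [\un c] yields [a = c \un c], and the
   involution [x |-> x \un x] recovers [c]. *)
have aE : a = c \un c by rewrite {1}cE bikei_unK.
by rewrite aE un_diagK bikei_ov_un -bikei_diag !eqxx.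
Qed.

Lemma eq_un_diag a b : (b == a \un a) = (a == b \un b).
Proof. by apply/eqP/eqP=> ->; rewrite un_diagK. Qed.

(** The crossing is solved for its right ends in terms of its left ones, as needed when colors are
    propagated sideways through a tangle. *)
Lemma crossing_flip a b c d :
  (c == a \un b) && (d == b \ov a) = (b == d \ov a) && (c == a \un d).
Proof. by apply/andP/andP=> -[/eqP-> /eqP->]; rewrite !bikei_simpl !eqxx. Qed.

Lemma crossing_loop_right a b c :
  (c == a \un b) && (a == b \ov a) = (b == c) && (b == a \un a).
Proof.
rewrite crossing_turn crossing_loop_side eq_sym.
by case: eqP => //= ->; rewrite eq_un_diag.
Qed.

(** This and the next two lemmas compare the final colors of the lowest, highest and middle strands,
    computed along the two sides of move III. Each is an exchange law once an operand is rewritten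
    to fit it. *)
Lemma third_move_low x y z :
  (x \un (z \ov y)) \un (y \un z) = (x \un y) \un z.
Proof. by rewrite -(bikei_un_ov y) bikei_exch_uu bikei_ovK. Qed.

Lemma third_move_top x y z :
  (z \ov (x \un y)) \ov (y \ov x) = (z \ov y) \ov x.
Proof. by rewrite -{1}[z](bikei_ovK _ y) -bikei_exch_oo bikei_ovK. Qed.

Lemma third_move_mid x y z :
  (y \un z) \ov (x \un (z \ov y)) = (y \ov x) \un (z \ov (x \un y)).
Proof.
rewrite -[in LHS](bikei_un_ov y z) bikei_exch_uo -third_move_top.
by rewrite bikei_un_ov.
Qed.

Section Weights.
Variables (A : zmodType) (w : X -> X -> A).
Hypothesis wP : cocycle_laws w.
Local Open Scope ring_scope.

Lemma weight_un_diag x : w x (x \un x) = 0.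
Proof. by rewrite bikei_diag (weight_ov wP) (weight_diag wP) oppr0. Qed.

(** The cocycle identity at [(x, y, z \ov y)]. *)
Lemma weight_third_move x y z :
  w y z + w x (z \ov y) + w (x \un (z \ov y)) (y \un z) =
  w x y + w (x \un y) z + w (y \ov x) (z \ov (x \un y)).
Proof.
have := weight_cocycle wP x y (z \ov y).
(* Two terms, [w y (z \ov y)] and [w (y \ov x) ((z \ov y) \ov x)], change sign by [weight_ov]; the
   six terms then become the weights of the six crossings. *)
rewrite bikei_ovK bikei_un_ov (weight_ov wP) -third_move_top (weight_ov wP).
move=> /esym/eqP; rewrite -subr_eq0 => /eqP E; apply: subr0_eq.
by rewrite -[RHS]E !opprD !opprK !addrA [RHS](ACl (5*1*3*4*6*2)).
Qed.

End Weights.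

End BikeiTheory.

(** * Local moves *)

Section PieceColorings.
Variables (X : bikeiType) (A : zmodType) (w : X -> X -> A).
Local Open Scope ring_scope.

Definition piece_colored (E : Type) (f : E -> X) (p : piece E) : bool :=
  match p with
  | Crossing a b c d => (f c == f a \un f b) && (f d == f b \ov f a)
  | Saddle _ a b c d => [&& f a == f b, f b == f c & f c == f d]
  | Joint a b => f a == f b
  end.

Definition piece_weight (E : Type) (f : E -> X) (p : piece E) : A :=
  if p is Crossing a b _ _ then w (f a) (f b) else 0.

Definition colored (E : Type) (f : E -> X) (P : seq (piece E)) : bool :=
  all (piece_colored f) P.

Definition weight (E : Type) (f : E -> X) (P : seq (piece E)) : A :=
  \sum_(p <- P) piece_weight f p.

Definition labels (E : Type) (P : seq (piece E)) : seq E :=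
  flatten (map (@ends E) P).

(** [I] lists the internal and [B] the boundary labels of the tangle [T]: a
    coloring of [T] is a coloring of [B] satisfying [r], extended to [I] by
    [g], and its weight is then [z]. *)
Definition solved_by (T : seq (piece nat)) (I B : seq nat)
    (r : (nat -> X) -> bool) (g : (nat -> X) -> seq X) (z : (nat -> X) -> A) :=
  [/\ perm_eq (labels T) (I ++ I ++ B),
      forall f, size (g f) = size I,
      forall f f', map f B = map f' B ->
        [/\ r f = r f', g f = g f' & z f = z f'],
      forall f, colored f T = r f && (map f I == g f)
    & forall f, r f -> map f I == g f -> weight f T = z f].

Hypothesis wP : cocycle_laws w.

Definition weight_simpl := (weight_un_diag wP, weight_ov wP, weight_un wP,
  weight_both wP, weight_diag wP).

Ltac solve_eqs :=
  repeat match goal with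
  | H : is_true (andb _ _) |- _ => move/andP: H => [? ?]
  | H : is_true (eq_op _ _) |- _ => move/eqP: H => ?; subst
  end.

(** Only the values of [f] at the labels matter, so each becomes an arbitrary element of [X] bearing
    the name of its label; equations between colors can then be substituted. *)
Ltac name_colors f :=
  repeat match goal with
  | |- context [f ?x] => generalize (f x); clear x; intro x
  end.

Ltac expand_colored :=
  let f := fresh "f" in
  intro f; rewrite /colored /= ?eqseq_cons ?eqxx ?andbT; name_colors f.

Ltac solve_colored :=
  apply/idP/idP; let H := fresh in move=> H; solve_eqs;
  by rewrite ?bikei_simpl ?eqxx.

Ltac expand_weight :=
  let f := fresh "f" in
  intro f; rewrite /weight !(big_cons, big_nil) /= ?eqseq_cons; name_colors f;
  let H := fresh in move=> H; let H' := fresh in move=> H'; solve_eqs;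
  rewrite ?bikei_simpl ?weight_simpl ?opprK ?addr0 ?add0r ?addNr ?subrr
          ?addNKr ?addr0 ?addNr ?subrr //.

(** The label count, the size of [g] and the dependence on boundary colors are settled for both
    tangles; what may remain is the coloring condition and the weight of each. *)
Ltac expand_solved :=
  split;
  (split; [by apply/permP=> ? /=; ring | by []
          | by move=> ? ? /= []; do ! move=> -> | expand_colored
          | expand_weight]).

Lemma local_move_solved T T' : local_move T T' ->
  exists I I' B r g g' z, solved_by T I B r g z /\ solved_by T' I' B r g' z.
Proof.
case=> {T T'}.
(* The turned crossing has weight [w (a \un b) (b \ov a)], which is [w a b] by [weight_both]. *)
- move=> a b c d.
  exists [::], [::], [:: a; b; c; d].
  exists (fun f => (f c == f a \un f b) && (f d == f b \ov f a)).
  exists (fun=> [::]), (fun=> [::]), (fun f => w (f a) (f b)).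
  by expand_solved; rewrite // -crossing_turn.
- move=> m a b c d.
  exists [::], [::], [:: a; b; c; d].
  exists (fun f => [&& f a == f b, f b == f c & f c == f d]).
  exists (fun=> [::]), (fun=> [::]), (fun f => 0).
  by expand_solved; solve_colored.
- move=> a b.
  exists [::], [::], [:: a; b].
  exists (fun f => f a == f b).
  exists (fun=> [::]), (fun=> [::]), (fun f => 0).
  by expand_solved; solve_colored.
(* A kink forces equal ends and loop color [a \un a]. Its weight is [w a a] here and [w a (a \un a)]
   in the next case, both zero. *)
- move=> a b c.
  exists [:: c], [::], [:: a; b].
  exists (fun f => f a == f b).
  exists (fun f => [:: f a \un f a]), (fun=> [::]), (fun f => 0).
  by expand_solved; rewrite // crossing_loop_out.
- move=> a b c.
  exists [:: c], [::], [:: a; b].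
  exists (fun f => f a == f b).
  exists (fun f => [:: f a \un f a]), (fun=> [::]), (fun f => 0).
  by expand_solved; rewrite // crossing_loop_side.
(* Read sideways, the first crossing determines [m] and [n] from [a] and [c]; the weights [w c m]
   and [w n m] are opposite since [n] has color [c \un m]. *)
- move=> a b c d m n.
  exists [:: m; n], [::], [:: a; b; c; d].
  exists (fun f => (f a == f b) && (f c == f d)).
  exists (fun f => [:: f a \ov f c; f c \un f a]), (fun=> [::]), (fun=> 0).
  by expand_solved; rewrite ?(crossing_flip c); solve_colored.
- move=> a1 a2 a3 b1 b2 b3 p q r p' q' r'.
  exists [:: p; q; r], [:: p'; q'; r'], [:: a1; a2; a3; b1; b2; b3].
  exists (fun f => [&& f b3 == (f a1 \un f a2) \un f a3,
    f b2 == (f a2 \ov f a1) \un (f a3 \ov (f a1 \un f a2))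
    & f b1 == (f a3 \ov f a2) \ov f a1]).
  exists (fun f => [:: f a1 \un f a2; f a2 \ov f a1;
    f a3 \ov (f a1 \un f a2)]).
  exists (fun f => [:: f a2 \un f a3; f a3 \ov f a2;
    f a1 \un (f a3 \ov f a2)]).
  exists (fun f => w (f a1) (f a2) + w (f a1 \un f a2) (f a3)
    + w (f a2 \ov f a1) (f a3 \ov (f a1 \un f a2))).
  expand_solved.
  + by rewrite -third_move_top; solve_colored.
  + by rewrite addrA.
  + by rewrite -third_move_low -third_move_mid; solve_colored.
  + by rewrite addrA weight_third_move.
(* Solving the crossings sideways exchanges [\un] and [\ov] in the formulas of the previous case,
   and [weight_ov] negates every weight. The weight identity is then the previous one with the
   strands in reverse order. *)
- move=> a1 a2 a3 b1 b2 b3 p q r p' q' r'.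
  exists [:: p; q; r], [:: p'; q'; r'], [:: a1; a2; a3; b1; b2; b3].
  exists (fun f => [&& f b3 == (f a1 \ov f a2) \ov f a3,
    f b2 == (f a2 \un f a1) \ov (f a3 \un (f a1 \ov f a2))
    & f b1 == (f a3 \un f a2) \un f a1]).
  exists (fun f => [:: f a1 \ov f a2; f a2 \un f a1;
    f a3 \un (f a1 \ov f a2)]).
  exists (fun f => [:: f a2 \ov f a3; f a3 \un f a2;
    f a1 \ov (f a3 \un f a2)]).
  exists (fun f => - (w (f a2) (f a1) + w (f a3) (f a1 \ov f a2)
    + w (f a3 \un (f a1 \ov f a2)) (f a2 \un f a1))).
  expand_solved.
  + rewrite -third_move_low (crossing_flip a2) (crossing_flip a3).
    by rewrite (crossing_flip r); solve_colored.
  + by rewrite !opprD addrA.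
  + rewrite third_move_mid -third_move_top (crossing_flip a3).
    by rewrite (crossing_flip q') (crossing_flip p'); solve_colored.
  + rewrite -third_move_top (weight_ov wP) (weight_third_move wP).
    by rewrite !opprD addrA.
- move=> k a b c d s t m p q m' p' q'.
  exists [:: m; p; q], [:: m'; p'; q'], [:: a; b; c; d; s; t].
  exists (fun f => [&& f a == f b, f c == f d, f s == f t
    & f c == f a \un f t]).
  exists (fun f => [:: f t \ov f a; f c; f c]).
  exists (fun f => [:: f t \ov f a; f a; f a]), (fun=> 0).
  expand_solved.
  + apply/idP/idP=> H; solve_eqs; last by rewrite ?bikei_simpl ?eqxx.
    (* The vertex equates [a \un m] with [b \un t], where [m = t \ov b]. Since [b \un t = b \un m],
       cancelling [\un m] identifies the two arms. *)
    have -> : a = b by apply: (@un_injr X (t \ov b)); rewrite bikei_un_ov.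
    by rewrite ?bikei_simpl ?eqxx.
  + by solve_colored.
- move=> k a b c d s t m p q m' p' q'.
  exists [:: m; p; q], [:: m'; p'; q'], [:: a; b; c; d; s; t].
  exists (fun f => [&& f a == f b, f c == f d, f s == f t
    & f c == f a \ov f s]).
  exists (fun f => [:: f s \un f a; f c; f c]).
  exists (fun f => [:: f s \un f a; f a; f a]), (fun=> 0).
  expand_solved.
  + apply/idP/idP=> H; solve_eqs; last by rewrite ?bikei_simpl ?eqxx.
    have -> : a = b by apply: (@ov_injr X (s \un a)); rewrite bikei_ov_un.
    by rewrite ?bikei_simpl ?eqxx.
  + by solve_colored.
(* The vertex gives two adjacent ends of the crossing the same color, so the crossing is colored
   like a kink and has weight zero. *)
- move=> k a b c d p q p' q'.
  exists [:: p; q], [:: p'; q'], [:: a; b; c; d].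
  exists (fun f => [&& f a == f d, f b == f c & f b == f a \un f a]).
  exists (fun f => [:: f a; f a]), (fun f => [:: f b; f b]), (fun=> 0).
  expand_solved.
  + apply/idP/idP=> [/andP[/and3P[/eqP<- /eqP<- /eqP->]]|].
      rewrite crossing_loop_right => /andP[/eqP-> /eqP dE].
      by rewrite -dE !eqxx.
    case/andP=> /and3P[/eqP-> /eqP-> cE] /andP[/eqP-> /eqP->].
    by rewrite !eqxx crossing_loop_right eqxx.
  + apply/idP/idP=> [/andP[adE /and3P[/eqP pE /eqP bE /eqP cE]]|].
      by move: adE; rewrite -cE -bE pE crossing_loop_side => /andP[-> ->];
         rewrite !eqxx.
    case/andP=> /and3P[adE /eqP<- bE] /andP[/eqP-> /eqP->].
    by rewrite crossing_loop_side adE bE !eqxx.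
- move=> k a b c d p q p' q'.
  exists [:: p; q], [:: p'; q'], [:: a; b; c; d].
  exists (fun f => [&& f a == f d, f b == f c & f b == f a \un f a]).
  exists (fun f => [:: f a; f a]), (fun f => [:: f b; f b]), (fun=> 0).
  expand_solved.
  + apply/idP/idP=> [/andP[/and3P[/eqP<- /eqP<- /eqP->]]|].
      by rewrite crossing_loop_out eq_un_diag => /andP[-> ->]; rewrite !eqxx.
    case/andP=> /and3P[/eqP-> bcE] bE /andP[/eqP-> /eqP->].
    by rewrite crossing_loop_out bcE -eq_un_diag bE !eqxx.
  + apply/idP/idP=> H; solve_eqs; rewrite -?bikei_diag.
      by rewrite ?bikei_simpl ?eqxx.
    by rewrite ?bikei_simpl ?eqxx.
- move=> k a b c.
  exists [:: c], [::], [:: a; b].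
  exists (fun f => f a == f b).
  exists (fun f => [:: f a]), (fun=> [::]), (fun=> 0).
  by expand_solved; solve_colored.
- move=> x1 x2 x3 x4 x5 x6 e e'.
  exists [:: e], [:: e'], [:: x1; x2; x3; x4; x5; x6].
  exists (fun f => all (fun x => f x == f x1) [:: x2; x3; x4; x5; x6]).
  exists (fun f => [:: f x1]), (fun f => [:: f x1]), (fun=> 0).
  by expand_solved; solve_colored.
(* Parallel arms of a vertex share one color, so a strand crossing both of them has its color
   changed and then restored; the four weights cancel in pairs. *)
- move=> k a1 a2 b1 b2 c1 c2 d1 d2 p q r s p1 q1 r1 s1.
  move=> p' q' r' s' p1' q1' r1' s1'.
  exists [:: p; q; r; s; p1; q1; r1; s1].
  exists [:: p'; q'; r'; s'; p1'; q1'; r1'; s1'].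
  exists [:: a1; a2; b1; b2; c1; c2; d1; d2].
  exists (fun f => all (fun x => f x == f a1) [:: a2; c1; c2]
    && all (fun x => f x == f b1) [:: b2; d1; d2]).
  exists (fun f => [:: f a1; f a1; f b1; f b1; f a1 \ov f b1;
    f a1 \ov f b1; f b1 \un f a1; f b1 \un f a1]).
  exists (fun f => [:: f a1; f a1; f b1; f b1; f a1 \un f b1;
    f a1 \un f b1; f b1 \ov f a1; f b1 \ov f a1]), (fun=> 0).
  expand_solved.
  + rewrite (crossing_flip r) (crossing_flip s) (crossing_flip r1).
    by rewrite (crossing_flip s1); solve_colored.
  + by solve_colored.
Qed.

End PieceColorings.

(** * Moves between labelled families of pieces *)

Section Labels.

Lemma labels_cat E (P Q : seq (piece E)) :
  labels (P ++ Q) = labels P ++ labels Q.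
Proof. by rewrite /labels map_cat flatten_cat. Qed.

Lemma labels_relabel E F (s : E -> F) (P : seq (piece E)) :
  labels (map (relabel s) P) = map s (labels P).
Proof.
by rewrite /labels map_flatten -!map_comp; congr flatten; apply: eq_map; case.
Qed.

Lemma perm_labels (E : eqType) (P Q : seq (piece E)) :
  perm_eq P Q -> perm_eq (labels P) (labels Q).
Proof. by move=> PQ; apply/perm_flatten/perm_map. Qed.

Lemma labels_nil E (P : seq (piece E)) : labels P = [::] -> P = [::].
Proof. by case: P => [|[]]. Qed.

Definition twice_labelled (E : eqType) (P : seq (piece E)) : Prop :=
  {in labels P, forall e, count_mem e (labels P) = 2}.

(** The two copies of [I] already exhaust the two occurrences allowed to a label of [I]. *)
Lemma twice_labelled_internal (E : eqType) (P : seq (piece E)) (I L : seq E) :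
  twice_labelled P -> perm_eq (labels P) (I ++ I ++ L) ->
  uniq I /\ {in I, forall e, e \notin L}.
Proof.
move=> P2 PE; have cntI e : e \in I -> count_mem e I = 1 /\ count_mem e L = 0.
  move=> eI; have eP : e \in labels P by rewrite (perm_mem PE) mem_cat eI.
  have := P2 e eP; rewrite (permP PE) !count_cat.
  move: eI; rewrite -has_pred1 has_count.
  by case: (count _ I) (count _ L) => [|[|n]] [|m] //=; rewrite !(addSn, addnS).
split; last by move=> e /cntI[_ /count_memPn].
by apply/count_mem_uniq => e; case: (boolP (e \in I)) => [/cntI[]|/count_memPn].
Qed.

End Labels.

(** * Transfer of colorings from one side of a move to the other *)

Section Transfer.
Variables (X : bikeiType) (A : zmodType) (w : X -> X -> A).
Local Open Scope ring_scope.

Lemma eq_in_colored (E : eqType) (f f' : E -> X) (P : seq (piece E)) :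
  {in labels P, f =1 f'} -> colored f P = colored f' P.
Proof.
elim: P => //= p P IH ff'; rewrite IH => [|e eP]; last first.
  by apply: ff'; rewrite mem_cat eP orbT.
have {}ff' : {in ends p, f =1 f'}.
  by move=> e ep; apply: ff'; rewrite mem_cat ep.
by congr andb; case: p ff' => [a b c d|m a b c d|a b] /= ff';
   rewrite !ff' // !inE eqxx ?orbT.
Qed.

Lemma eq_in_weight (E : eqType) (f f' : E -> X) (P : seq (piece E)) :
  {in labels P, f =1 f'} -> weight w f P = weight w f' P.
Proof.
rewrite /weight; elim: P => [|p P IH ff']; first by rewrite !big_nil.
rewrite !big_cons IH => [|e eP]; last by apply: ff'; rewrite mem_cat eP orbT.
have {}ff' : {in ends p, f =1 f'}.
  by move=> e ep; apply: ff'; rewrite mem_cat ep.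
by congr +%R; case: p ff' => [a b c d|//|//] /= ff';
   rewrite !ff' // !inE eqxx ?orbT.
Qed.

Lemma colored_relabel E F (s : E -> F) (f : F -> X) (P : seq (piece E)) :
  colored f (map (relabel s) P) = colored (f \o s) P.
Proof. by rewrite /colored all_map; apply: eq_all; case. Qed.

Lemma weight_relabel E F (s : E -> F) (f : F -> X) (P : seq (piece E)) :
  weight w f (map (relabel s) P) = weight w (f \o s) P.
Proof. by rewrite /weight big_map; apply: eq_bigr => -[]. Qed.

Lemma perm_colored (E : eqType) (f : E -> X) (P Q : seq (piece E)) :
  perm_eq P Q -> colored f P = colored f Q.
Proof. exact: perm_all. Qed.

Lemma perm_weight (E : eqType) (f : E -> X) (P Q : seq (piece E)) :
  perm_eq P Q -> weight w f P = weight w f Q.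
Proof. exact: perm_big. Qed.

Lemma colored_cat E (f : E -> X) (P Q : seq (piece E)) :
  colored f (P ++ Q) = colored f P && colored f Q.
Proof. exact: all_cat. Qed.

Lemma weight_cat E (f : E -> X) (P Q : seq (piece E)) :
  weight w f (P ++ Q) = weight w f P + weight w f Q.
Proof. exact: big_cat. Qed.

Lemma update_on (E : eqType) (f : E -> X) (I : seq E) (v : seq X) :
  uniq I -> size v = size I ->
  (* The default of [nth] is the old value [f e], which is returned outside [I], where the index
     overflows. *)
  exists2 f', map f' I = v & {in predC (mem I), f' =1 f}.
Proof.
move=> I_uniq vI; exists (fun e => nth (f e) v (index e I)) => [|e eI].
  case: I I_uniq vI => [|e0 I] I_uniq vI; first by move/size0nil: vI => ->.
  apply: (@eq_from_nth _ (f e0)) => [|i]; rewrite size_map // => iI.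
  by rewrite (nth_map e0) // index_uniq //; apply: set_nth_default; rewrite vI.
by rewrite nth_default // memNindex ?vI.
Qed.

(** [S] is the set of labels on which colorings of [P] and [Q] are compared.
    Labels internal to the modified tangle must be excluded, since the two
    sides may use the same number for unrelated internal edges. *)
Definition transfers (S : seq nat) (P Q : seq (piece nat)) : Prop :=
  [/\ {subset S <= labels P},
      forall f f' : nat -> X, colored f P -> colored f' P ->
        {in S, f =1 f'} -> {in labels P, f =1 f'}
    & forall f, colored f P -> exists f',
        [/\ colored f' Q, {in S, f =1 f'} & weight w f' Q = weight w f P]].

(** Internal colors are functions of the boundary colors, hence uniqueness. For existence, the
    coloring is kept on [B] and [R] and overwritten by [g'] on [I'], which is disjoint from these
    labels because every label of [Q] occurs twice. *)
Lemma solved_transfers T T' R P Q I I' B r g g' z :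
  solved_by w T I B r g z -> solved_by w T' I' B r g' z ->
  twice_labelled P -> twice_labelled Q ->
  perm_eq P (T ++ R) -> perm_eq Q (T' ++ R) -> transfers (B ++ labels R) P Q.
Proof.
move=> [TE sg dep colT weT] [TE' sg' dep' colT' weT'] P2 Q2 PE QE.
have PL : perm_eq (labels P) (I ++ I ++ (B ++ labels R)).
  by rewrite (perm_trans (perm_labels PE)) // labels_cat !catA perm_cat2r -catA.
have QL : perm_eq (labels Q) (I' ++ I' ++ (B ++ labels R)).
  by rewrite (perm_trans (perm_labels QE)) // labels_cat !catA perm_cat2r -catA.
split.
- by move=> e eS; rewrite (perm_mem PL) !mem_cat -(mem_cat e B) eS !orbT.
- move=> f f'; rewrite !(perm_colored _ PE) !colored_cat !colT.
  move=> /andP[/andP[_ /eqP fI] _] /andP[/andP[_ /eqP f'I] _] ff' e.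
  have /dep[_ gE _] : map f B = map f' B.
    by apply/eq_in_map => x xB; apply: ff'; rewrite mem_cat xB.
  have /eq_in_map fI' : map f I = map f' I by rewrite fI f'I gE.
  rewrite (perm_mem PL) mem_cat orbC mem_cat.
  by case/orP=> [/orP[/fI'|/ff']|/fI'].
move=> f; rewrite !(perm_colored _ PE) !colored_cat !colT.
move=> /andP[/andP[rf fI] fR].
have [I'_uniq I'S] := twice_labelled_internal Q2 QL.
have [f' f'I f'S] := update_on f I'_uniq (sg' f).
have {}f'S : {in B ++ labels R, f =1 f'}.
  move=> e eS; rewrite f'S //; apply/negP => /= eI'.
  by have := I'S e eI'; rewrite eS.
have fB : map f B = map f' B.
  by apply/eq_in_map => x xB; apply: f'S; rewrite mem_cat xB.
have fLR : {in labels R, f =1 f'}.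
  by move=> e eR; apply: f'S; rewrite mem_cat eR orbT.
have [rE gE zE] := dep _ _ fB; have [rE' gE' zE'] := dep' _ _ fB.
exists f'; split=> //.
  rewrite (perm_colored _ QE) colored_cat colT' -rE rf f'I gE' eqxx.
  by rewrite -(eq_in_colored fLR).
rewrite (perm_weight _ QE) (perm_weight _ PE) !weight_cat -(eq_in_weight fLR).
by rewrite weT' -?rE ?f'I ?gE' // weT // zE.
Qed.

Hypothesis wP : cocycle_laws w.

Lemma code_move_transfers P Q : twice_labelled P -> twice_labelled Q ->
  code_move P Q -> exists S, transfers S P Q /\ transfers S Q P.
Proof.
move=> P2 Q2 [PQ | T T' R TT' PE QE | a b R ab PE QE].
- exists (labels P); have LPQ := perm_mem (perm_labels PQ).
  split; split=> //.
  + by move=> f fP; exists f; rewrite -(perm_colored _ PQ) (perm_weight _ PQ).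
  + by move=> e; rewrite LPQ.
  + by move=> f f' _ _ ff' e; rewrite -LPQ; apply: ff'.
  + by move=> f fQ; exists f; rewrite (perm_colored _ PQ) (perm_weight _ PQ).
- have [I [I' [B [r [g [g' [z [TP T'P]]]]]]]] := local_move_solved wP TT'.
  exists (B ++ labels R); split.
    exact: (solved_transfers TP T'P P2 Q2 PE QE).
  exact: (solved_transfers T'P TP Q2 P2 QE PE).
set s := fun e => _ in QE.
have PL := perm_mem (perm_labels PE); have QL := perm_mem (perm_labels QE).
rewrite labels_relabel in QL.
(* As [a] and [b] differ, the joint uses only one of the two occurrences of [a]. *)
have aR : a \in labels R.
  have := P2 a; rewrite PL mem_head (permP (perm_labels PE)) /= eqxx eq_sym.
  rewrite (negbTE ab) add0n => /(_ isT)[cnt].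
  by rewrite -has_pred1 has_count (cnt : count_mem a (labels R) = 1).
have sb e : e != b -> s e = e by rewrite /s; case: eqP.
have sbb : s b = a by rewrite /s eqxx.
have colP (f : nat -> X) : colored f P = (f a == f b) && colored f R.
  by rewrite (perm_colored _ PE).
have weP (f : nat -> X) : weight w f P = weight w f R.
  by rewrite (perm_weight _ PE) /weight big_cons add0r.
have colQ (f : nat -> X) : colored f Q = colored (f \o s) R.
  by rewrite (perm_colored _ QE) colored_relabel.
have weQ (f : nat -> X) : weight w f Q = weight w (f \o s) R.
  by rewrite (perm_weight _ QE) weight_relabel.
(* Contracting the joint removes [b] from the labels; its color is recovered from that of [a]. *)
exists [seq e <- labels P | e != b]; split; split.
- by move=> e; rewrite mem_filter => /andP[].
- move=> f f'; rewrite !colP => /andP[/eqP fab _] /andP[/eqP f'ab _] ff' e eP.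
  have [->|eb] := eqVneq e b; last by apply: ff'; rewrite mem_filter eb.
  by rewrite -fab -f'ab; apply: ff'; rewrite mem_filter ab PL mem_head.
- move=> f; rewrite colP => /andP[/eqP fab fR]; exists f.
  have fs : f =1 f \o s by move=> e /=; rewrite /s; case: eqP => [->|].
  have fsR : {in labels R, f =1 f \o s} by move=> e _; apply: fs.
  by rewrite colQ weQ weP -(eq_in_colored fsR) -(eq_in_weight fsR).
- move=> e; rewrite mem_filter PL !inE QL => /andP[eb].
  rewrite (negbTE eb) /= => /orP[/eqP->|eR]; last by rewrite -(sb e) // map_f.
  by rewrite -[a](sb a) // map_f.
- move=> f f' _ _ ff' e; rewrite QL => /mapP[x xR ->]; apply: ff'.
  rewrite mem_filter PL !inE; have [->|xb] := eqVneq x b.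
    by rewrite sbb ab eqxx.
  by rewrite sb // xb xR !orbT.
move=> f fQ; exists (f \o s).
rewrite colP weP -colQ fQ -weQ /= (sb a) // sbb eqxx; split=> // e.
by rewrite mem_filter => /andP[eb _]; rewrite /= sb.
Qed.

End Transfer.

(** * Diagrams *)

Section Extension.
Variables (D : mdiagram) (X : finBikeiType).
Notation coloring := (bikei_hom (fundamental_bikei D) X).

Lemma color_colored (h : coloring) : colored (color h) (pieces D).
Proof.
have colorE u v : bk_eq u v -> h (bk_class u) = h (bk_class v).
  by move=> /bk_classP ->.
apply/allP => -[a b c d|m a b c d|a b] pD /=.
- have cE := colorE _ _ (bk_crossing_under pD).
  have dE := colorE _ _ (bk_crossing_over pD).
  rewrite -bk_unE (bikei_hom_un h) in cE.
  rewrite -bk_ovE (bikei_hom_ov h) in dE.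
  by rewrite /color cE dE !eqxx.
- rewrite /color (colorE _ _ (bk_saddle12 pD)) (colorE _ _ (bk_saddle23 pD)).
  by rewrite (colorE _ _ (bk_saddle34 pD)) eqxx.
rewrite /color; suff -> : semiarc_of a = semiarc_of b by [].
by apply/eqquotP/connect1; rewrite /joined /= pD.
Qed.

Section Evaluation.
Variable c : edge D -> X.
Hypothesis cP : colored c (pieces D).

Lemma colored_joined a b : connect (@joined D) a b -> c a = c b.
Proof.
move=> /connectP[s]; elim: s a => [|e s IH] a /= => [_ ->//|].
move=> /andP[ae es bE]; rewrite -(IH e es bE).
by case/orP: ae => /(allP cP)/eqP.
Qed.

Fixpoint word_color (u : bword (semiarc D)) : X :=
  match u with
  | Gen s => c (repr s)
  | Un u v => word_color u \un word_color v
  | Ov u v => word_color u \ov word_color v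
  end.

Lemma word_color_arc a : word_color (Gen (semiarc_of a)) = c a.
Proof.
have /eqquotP : semiarc_of (repr (semiarc_of a)) = semiarc_of a.
  by rewrite /semiarc_of reprK.
exact: colored_joined.
Qed.

Lemma bk_eq_word_color u v : bk_eq u v -> word_color u = word_color v.
Proof.
have pieceP := allP cP.
have arcE a : c (repr (semiarc_of a)) = c a := word_color_arc a.
elim=> {u v} //= [u v w _ -> _ -> //|u u' v v' _ -> _ ->//|u u' v v' _ -> _ ->//
  |u|u v|u v|u v|u v|u v w|u v w|u v w|a b c' d|a b c' d
  |m a b c' d|m a b c' d|m a b c' d].
- exact: bikei_diag.
- exact: bikei_ovK.
- exact: bikei_unK.
- exact: bikei_un_ov.
- exact: bikei_ov_un.
- exact: bikei_exch_oo.
- exact: bikei_exch_uo.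
- exact: bikei_exch_uu.
- by rewrite !arcE => /pieceP/andP[/eqP].
- by rewrite !arcE => /pieceP/andP[_ /eqP].
- by rewrite !arcE => /pieceP/and3P[/eqP].
- by rewrite !arcE => /pieceP/and3P[_ /eqP].
- by rewrite !arcE => /pieceP/and3P[_ _ /eqP].
Qed.

(** This is the universal property of the presentation: evaluation of words respects [bk_eq], hence
    descends to the quotient. *)
Lemma colored_extends : exists h : coloring, color h =1 c.
Proof.
pose h (x : fundamental_bikei D) := word_color (repr x).
have hE u : h (bk_class u) = word_color u.
  by apply/bk_eq_word_color/bk_classP; rewrite /bk_class reprK.
have hun : {morph h : x y / x \un y} by move=> x y; apply: hE.
have hov : {morph h : x y / x \ov y} by move=> x y; apply: hE.
by exists (BikeiHom hun hov) => a; rewrite /color /= hE word_color_arc.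
Qed.

End Evaluation.

End Extension.

(** * Weight-preserving bijections between the colorings of two diagrams *)

Section DiagramMoves.
Variables (X : finBikeiType) (A : zmodType) (w : X -> X -> A).
Hypothesis wP : cocycle_laws w.
Local Open Scope ring_scope.
Local Notation coloring D := (bikei_hom (fundamental_bikei D) X).

Lemma BW_weight D (h : coloring D) : BW w h = weight w (color h) (pieces D).
Proof. by []. Qed.

Lemma mem_labels D (e : edge D) : e \in labels (pieces D).
Proof.
have /forallP/(_ e)/eqP eD := pieces_two_ended D.
by rewrite -has_pred1 has_count [count _ _]eD.
Qed.

Lemma twice_labelled_diagram D (fn : edge D -> nat) :
  injective fn -> twice_labelled (map (relabel fn) (pieces D)).
Proof.
move=> fn_inj n; rewrite labels_relabel => /mapP[e _ {n}->].
rewrite count_map (@eq_count _ _ (pred1 e)) => [|x /=]; last by rewrite inj_eq.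
by have /forallP/(_ e)/eqP := pieces_two_ended D.
Qed.

(** This serves the case of empty [X], where only a diagram without pieces is colorable. Contraction
    could empty a family only if it were a single joint with distinct ends, whose labels would occur
    once each. *)
Lemma code_move_nilp P Q : twice_labelled P -> code_move P Q -> nilp P = nilp Q.
Proof.
move=> P2 [/perm_size PQ|T T' R TT' /perm_size PE /perm_size QE|a b R ab PE QE].
- by rewrite /nilp PQ.
- by rewrite /nilp PE QE !size_cat; case: TT'.
case: R PE QE => [PE _|p R /perm_size PE /perm_size QE]; last first.
  by rewrite /nilp PE QE.
have := P2 a; rewrite (perm_mem (perm_labels PE)) (permP (perm_labels PE)) /=.
by rewrite mem_head eqxx eq_sym (negbTE ab) => /(_ isT).
Qed.

Lemma extend_names (E : finType) (fn : E -> nat) (x0 : X) :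
  injective fn -> forall c : E -> X, exists f : nat -> X, f \o fn =1 c.
Proof.
move=> fn_inj c; exists (fun n => oapp c x0 [pick e | fn e == n]) => e /=.
by case: pickP => [e' /eqP/fn_inj->|/(_ e)] //; rewrite eqxx.
Qed.

Lemma transfers_injection D D' (fn : edge D -> nat) (gn : edge D' -> nat) S :
  let P := map (relabel fn) (pieces D) in
  let Q := map (relabel gn) (pieces D') in
  injective fn -> injective gn -> nilp P = nilp Q ->
  transfers w S P Q -> {subset S <= labels Q} ->
  exists2 F : coloring D -> coloring D',
    injective F & forall h, BW w (F h) = BW w h.
Proof.
move=> P Q fn_inj gn_inj PQ [SP uniqP extP] SQ.
pose agree (h : coloring D) (k : coloring D') :=
  forall e e', fn e = gn e' -> fn e \in S -> color h e = color k e'.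
have total h : exists2 k, agree h k & BW w k = BW w h.
  (* Without a default color, colorings of [D] do not extend to all names. *)
  case: (pickP (xpredT : pred X)) => [x0 _|noX]; last first.
    have P0 : pieces D = [::].
      by apply: labels_nil; case: labels => // e; have := noX (color h e).
    have Q0 : pieces D' = [::].
      by apply/nilP; rewrite /nilp -(size_map (relabel gn)) -[_ == _]PQ /P P0.
    have noE' (e' : edge D') : False by have := mem_labels e'; rewrite Q0.
    have c0P : colored (fun e' => match noE' e' return X with end) (pieces D').
      by rewrite Q0.
    have [k _] := colored_extends c0P; exists k => [e e'|].
      by case: (noE' e').
    by rewrite !BW_weight P0 Q0 /weight !big_nil.
  have [f fE] := extend_names x0 fn_inj (color h).
  have fP : colored f P.
    by rewrite colored_relabel (eq_in_colored (in1W fE)) color_colored.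
  have [f' [f'Q ff' wE]] := extP f fP.
  rewrite colored_relabel in f'Q; have [k kE] := colored_extends f'Q.
  exists k => [e e' ee' eS|]; first by rewrite kE -fE /= ff' // ee'.
  rewrite !BW_weight (eq_in_weight w (in1W kE)) -weight_relabel wE.
  by rewrite weight_relabel (eq_in_weight w (in1W fE)).
(* Two colorings that agree with the same [k] coincide on [S], hence on all labels of [P]. *)
have uniq_agree h h' k : agree h k -> agree h' k -> h = h'.
  move=> hk h'k; apply: color_ffun_inj; apply/ffunP => e; rewrite !ffunE.
  have [f fE] := extend_names (color h e) fn_inj (color h).
  have [f' f'E] := extend_names (color h e) fn_inj (color h').
  have fP : colored f P.
    by rewrite colored_relabel (eq_in_colored (in1W fE)) color_colored.
  have f'P : colored f' P.
    by rewrite colored_relabel (eq_in_colored (in1W f'E)) color_colored.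
  rewrite -fE -f'E /=; apply: (uniqP _ _ fP f'P); last first.
    by rewrite labels_relabel map_f ?mem_labels.
  move=> n nS; have := SP n nS; have := SQ n nS; rewrite !labels_relabel.
  move=> /mapP[e' _ nE'] /mapP[e1 _ nE].
  have -> : f n = color h e1 by rewrite -(fE e1) /= -nE.
  have -> : f' n = color h' e1 by rewrite -(f'E e1) /= -nE.
  by rewrite (hk e1 e') -?nE // (h'k e1 e') -?nE.
pose F h := projT1 (cid2 (total h)).
have FP h : agree h (F h) /\ BW w (F h) = BW w h by rewrite /F; case: cid2.
exists F => [h h' hh'|h]; last by have [] := FP h.
have [hF _] := FP h; have [h'F _] := FP h'; rewrite -hh' in h'F.
exact: uniq_agree hF h'F.
Qed.

Lemma diagram_move_bijection D D' : diagram_move D D' ->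
  exists2 F : coloring D -> coloring D',
    bijective F & forall h, BW w (F h) = BW w h.
Proof.
move=> [fn [gn [fn_inj gn_inj PQ]]].
have P2 := twice_labelled_diagram fn_inj.
have Q2 := twice_labelled_diagram gn_inj.
have nilPQ := code_move_nilp P2 PQ.
have [S [SPQ SQP]] := code_move_transfers wP P2 Q2 PQ.
have [SP _ _] := SPQ; have [SQ _ _] := SQP.
have [F F_inj FW] := transfers_injection fn_inj gn_inj nilPQ SPQ SQ.
have [G G_inj _] := transfers_injection gn_inj fn_inj (esym nilPQ) SQP SP.
(* The injection [G] bounds the number of colorings of [D'] by that of [D], so the injection [F]
   between finite sets is bijective. *)
by exists F => //; apply: inj_card_bij => //; apply: leq_card G_inj.
Qed.

Lemma yoshikawa_equiv_bijection D D' : yoshikawa_equiv D D' ->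
  exists2 F : coloring D -> coloring D',
    bijective F & forall h, BW w (F h) = BW w h.
Proof.
elim=> {D D'} [D D' /diagram_move_bijection //|D|D D' _ [F [G FK GK] FW]
  |D1 D2 D3 _ [F F_bij FW] _ [G G_bij GW]].
- by exists id => //; exists id.
- by exists G => [|h]; [exists F | rewrite -FW GK].
by exists (G \o F) => [|h]; [exact: bij_comp | rewrite /= GW FW].
Qed.

Lemma bijection_invariants D D' (F : coloring D -> coloring D') :
  bijective F -> (forall h, BW w (F h) = BW w h) ->
  PhiM w D = PhiM w D' /\ Phi w D = Phi w D'.
Proof.
move=> F_bij FW; split; last first.
  rewrite /Phi (reindex F) /=; last exact: onW_bij.
  by apply: eq_bigr => h _; rewrite FW.
apply/eq_seq_msetP; rewrite /image_mem (eq_map (fun h => esym (FW h))).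
rewrite (map_comp (@BW X A w D') F); apply: perm_map.
apply: uniq_perm => [||k].
- by rewrite (map_inj_uniq (bij_inj F_bij)) enum_uniq.
- exact: enum_uniq.
have [G FK GK] := F_bij.
by rewrite mem_enum -[k]GK map_f // mem_enum.
Qed.

End DiagramMoves.

Theorem theorem6 (X : finBikeiType) (A : zmodType)
    (h : HBK X A 2) (phi : cochain X A 2) (D D' : mdiagram) :
  h phi -> yoshikawa_equiv D D' ->
  PhiM (cocycle_fun phi) D = PhiM (cocycle_fun phi) D' /\
  Phi (cocycle_fun phi) D = Phi (cocycle_fun phi) D'.
Proof.
have [phi0 _ hE] := HBK_cosetP h; move=> /hE[/cocycle_fun_laws wP _].
move=> /(yoshikawa_equiv_bijection wP)[F F_bij FW].
exact: bijection_invariants F_bij FW.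
Qed.
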